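(* Let $\nu$ be an absolutely continuous probability distribution on $[-\pi,\pi]$ with continuous probability density, let ${\bf V}$ be the $N\times N$ random Vandermonde matrix with phases i.i.d. according to $\nu$, and let $\lambda_N$ be the maximum eigenvalue of ${\bf V}^*{\bf V}$. Then for any $0<\alpha<1$, $$\mathbb{P}\Big(\lambda_N\ge\frac{\alpha\log N}{\log\log N}\Big)=1-o(1)\quad\text{as }N\to\infty.$$
   Context: ${\bf V}=N^{-1/2}(e^{-j(k-1)\theta_l})_{1\le k,l\le N}$ with $\theta_1,\dots,\theta_N$ i.i.d. with law $\nu$. *)

(* Defs.v *)
(* MathComp + MathComp-Analysis (+ real-closed's complex numbers R[i]). *)
From HB Require Import structures.
From mathcomp Require Import all_boot all_order all_algebra.
From mathcomp Require Import all_classical all_reals all_analysis.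
From mathcomp Require Import complex.
Set Implicit Arguments. Unset Strict Implicit. Unset Printing Implicit Defensive.
Import Order.TTheory GRing.Theory Num.Theory numFieldNormedType.Exports.
Local Open Scope classical_set_scope.
Local Open Scope ring_scope.

(* Conjugate transpose of a complex matrix. *)
Definition adjmx {R : rcfType} {m n : nat} (A : 'M[R[i]]_(m, n)) : 'M[R[i]]_(n, m) :=
  (map_mx (fun z : R[i] => z^*) A)^T.

(* The N x N random Vandermonde matrix with phases th 0, ..., th (N-1):
   V k l = N^{-1/2} e^{-j k th_l}   (0-based k, l; the paper's (k-1) with 1-based k). *)
Definition vandermonde {R : realType} (N : nat) (th : nat -> R) : 'M[R[i]]_N :=
  \matrix_(k < N, l < N)
    ((Complex (cos (k%:R * th l)) (- sin (k%:R * th l))) / (Num.sqrt (N%:R : R))%:C)%C.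

(* Maximum eigenvalue of a (Hermitian) complex matrix: the supremum of its real
   eigenvalues (all eigenvalues of V^* V are real and nonnegative). *)
Definition lambda_max {R : realType} (N : nat) (M : 'M[R[i]]_N) : R :=
  sup [set x : R | eigenvalue M (Complex x 0)].

(* Mutual independence of a sequence of real random variables. *)
Definition mutually_independent {d} {T : measurableType d} {R : realType}
  (P : probability T R) (X : nat -> T -> R) : Prop :=
  forall (n : nat) (A : nat -> set R), (forall i, measurable (A i)) ->
    P (\bigcap_(i in `I_n) (X i @^-1` A i)) = (\prod_(i < n) P (X i @^-1` A i))%E.

(* nu is absolutely continuous, supported on [-pi, pi], with continuous density f. *)
Definition has_continuous_density_on_pi {R : realType} (nu : set R -> \bar R) (f : R -> R) : Prop :=
  (forall x, 0 <= f x) /\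
  {within `[- pi, (pi : R)]%classic, continuous f} /\
  forall A : set R, measurable A ->
    nu A = (\int[lebesgue_measure]_(x in A `&` `[- pi, pi]%classic%R) (f x)%:E)%E.

(* Main.v *)
Require Import Defs.
From HB Require Import structures.
From mathcomp Require Import all_boot all_order all_algebra.
From mathcomp Require Import all_classical all_reals all_analysis.
From mathcomp Require Import complex.
From mathcomp Require Import measurable_realfun ring lra.
Import Order.TTheory GRing.Theory Num.Theory numFieldNormedType.Exports.
Local Open Scope classical_set_scope.
Local Open Scope ring_scope.

(* If every phase of a set S of m phases lies within delta/N of the others, then
   testing V^*V against the indicator vector of S gives
   lambda_N >= (1/(Nm)) sum_k |sum_(l in S) e^(-jk theta_l)|^2 >= m cos(delta).
   On an interval where the density is positive, cut N bins of width delta/N: some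
   bin receives m ~ beta log N / log log N of the N phases with probability
   1 - o(1), for any alpha < beta < 1.  To see this, split the phases into m blocks
   of size n ~ N/m and count the pairs (b, s) such that, in each block i, the s(i)-th
   phase falls in bin b.  Counts for distinct bins are nonpositively correlated,
   since bins are disjoint, so the second moment method bounds the probability that
   no such pair exists by 2^m / sum_b (n p_b)^m, which is at most (Cm)^m / N.
   Measurability of the event lambda_N >= c, needed for its probability to be
   meaningful, follows from: lambda_N >= c iff tr((V^*V)^k) >= c^k for all k. *)

(** * Spectrum of a Gram matrix *)

Lemma adjmxM (R : rcfType) m n p (A : 'M[R[i]]_(m, n)) (B : 'M[R[i]]_(n, p)) :
  adjmx (A *m B) = adjmx B *m adjmx A.
Proof. by rewrite /adjmx map_mxM trmx_mul. Qed.

Lemma adjmxK (R : rcfType) m n (A : 'M[R[i]]_(m, n)) : adjmx (adjmx A) = A.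
Proof. by apply/matrixP => i j; rewrite !mxE conjCK. Qed.

Lemma gram_entry (R : rcfType) m n p (A : 'M[R[i]]_(m, n)) (B : 'M[R[i]]_(m, p)) i j :
  (adjmx A *m B) i j = \sum_k (A k i)^* * B k j.
Proof. by rewrite !mxE; apply: eq_bigr => k _; rewrite !mxE. Qed.

(** The Gram matrix is Hermitian, hence normal, so a unitary [U] diagonalizes it. Its i-th
    eigenvalue is the squared norm of column i of [V *m adjmx U], hence real and nonnegative. *)
Lemma gram_spectral (R : rcfType) n (V : 'M[R[i]]_n) :
  exists (U : 'M[R[i]]_n) (e : 'I_n -> R),
    [/\ adjmx U *m U = 1%:M, U *m adjmx U = 1%:M, forall i, 0 <= e i &
        adjmx V *m V = adjmx U *m diag_mx (\row_i (e i)%:C%C) *m U].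
Proof.
set M := adjmx V *m V.
have Mherm : M \is hermsymmx.
  apply/is_hermitianmxP; rewrite expr0 scale1r -map_trmx.
  by rewrite -[RHS]/(adjmx M) adjmxM adjmxK.
set U := spectralmx M.
have UU : U *m adjmx U = 1%:M.
  have /unitarymxP := spectral_unitarymx M.
  by rewrite -map_trmx.
have UU' : adjmx U *m U = 1%:M by exact: mulmx1C.
have iU : invmx U = adjmx U.
  by rewrite -[RHS]mulmx1 -(mulmxV (spectral_unit M)) mulmxA UU' mul1mx.
have := hermitian_normalmx Mherm => /orthomx_spectralP; rewrite -/U iU.
set D := spectral_diag M => MD.
have D_ge0 i : 0 <= D 0 i.
  have -> : D 0 i = (adjmx (V *m adjmx U) *m (V *m adjmx U)) i i.
    rewrite adjmxM adjmxK mulmxA -[U *m adjmx V *m V]mulmxA -/M MD !mulmxA UU mul1mx.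
    by rewrite -mulmxA UU mulmx1 mxE eqxx.
  by rewrite gram_entry; apply: sumr_ge0 => k _; rewrite mulrC mul_conjC_ge0.
exists U, (fun i => complex.Re (D 0 i)); split => //.
- by move=> i; have := D_ge0 i; rewrite lecE /= => /andP[].
- rewrite [LHS]MD; congr (_ *m diag_mx _ *m _); apply/rowP => i; rewrite mxE.
  by have := D_ge0 i; rewrite lecE; case: (D 0 i) => a b /= /andP[/eqP->].
Qed.

Section Spectrum.
Variables (R : realType) (n : nat) (U : 'M[R[i]]_n.+1) (e : 'I_n.+1 -> R).
Hypotheses (UU : adjmx U *m U = 1%:M) (UU' : U *m adjmx U = 1%:M).
Let D : 'M[R[i]]_n.+1 := diag_mx (\row_i (e i)%:C%C).
Let M := adjmx U *m D *m U.

(** The real eigenvalues of [M] are exactly the [e i], a finite set that is nonempty because the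
    size is [n.+1]; so the supremum is attained. *)
Lemma lambda_max_diag : exists2 i0, lambda_max M = e i0 & forall i, e i <= e i0.
Proof.
have specM x : eigenvalue M (x%:C)%C <-> exists i, x = e i.
  split.
    move=> /eigenvalueP[v vM v0].
    have vUD : (v *m adjmx U) *m D = (x%:C)%C *: (v *m adjmx U).
      have := congr1 (mulmx^~ (adjmx U)) vM.
      by rewrite /M !mulmxA -[_ *m U *m adjmx U]mulmxA UU' mulmx1 scalemxAl.
    have /rV0Pn[i vi] : v *m adjmx U != 0.
      apply: contraNneq v0 => vU0.
      by rewrite -[v]mulmx1 -UU mulmxA vU0 mul0mx.
    exists i; move: (v *m _) vUD vi => w /rowP/(_ i) + wi.
    by rewrite mul_mx_diag !mxE mulrC => /(mulIf wi) /complexI.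
  case=> i ->; apply/eigenvalueP; exists (delta_mx 0 i *m U).
    rewrite /M !mulmxA -[_ *m U *m adjmx U]mulmxA UU' mulmx1 scalemxAl; congr (_ *m U).
    by apply/rowP => j; rewrite mul_mx_diag !mxE eqxx /=; case: eqVneq => [->|_];
      rewrite ?mulr1 ?mul1r // mulr0 mul0r.
  apply/eqP => /(congr1 (mulmx^~ (adjmx U))).
  rewrite -mulmxA UU' mulmx1 mul0mx => /rowP/(_ i)/eqP.
  by rewrite !mxE !eqxx /= oner_eq0.
pose i0 := [arg max_(i > ord0) e i]%O.
have e_max i : e i <= e i0 by rewrite /i0; case: arg_maxP => // j _; exact.
exists i0 => //.
have in_i0 : [set x : R | eigenvalue M (x%:C)%C] (e i0) by apply/specM; exists i0.
apply/eqP; rewrite eq_le; apply/andP; split.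
  by apply: ge_sup; [exists (e i0) | move=> x /specM[i ->]].
apply: ub_le_sup => //; exists (e i0) => x /specM[i ->]; exact: e_max.
Qed.

(** In the coordinates y = U x the quadratic form is the sum of e_i |y_i|^2, and U preserves the
    norm. *)
Lemma diag_rayleigh (x : 'cV[R[i]]_n.+1) :
  (adjmx x *m M *m x) 0 0 <= (lambda_max M)%:C%C * (adjmx x *m x) 0 0.
Proof.
have [i0 -> e_max] := lambda_max_diag.
have -> : adjmx x *m M *m x = adjmx (U *m x) *m (D *m (U *m x)).
  by rewrite adjmxM /M !mulmxA.
have -> : adjmx x *m x = adjmx (U *m x) *m (U *m x).
  by rewrite adjmxM mulmxA -[_ *m U]mulmxA UU mulmx1.
rewrite !gram_entry mulr_sumr; apply: ler_sum => i _.
move: (U *m x) => y; rewrite mul_diag_mx !mxE mulrCA ler_wpM2r //.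
  by rewrite mulrC mul_conjC_ge0.
by rewrite lecR.
Qed.

Lemma diag_tr_exp k : \tr (M ^+ k) = (\sum_i e i ^+ k)%:C%C.
Proof.
have -> : M ^+ k = adjmx U *m diag_mx (\row_i (e i ^+ k)%:C%C) *m U.
  elim: k => [|k IH].
    rewrite expr0 (_ : \row_i _ = const_mx 1) ?diag_const_mx ?mulmx1 ?UU //.
    by apply/rowP => i; rewrite !mxE expr0.
  rewrite exprS IH -mulmxE /M !mulmxA -[_ *m U *m adjmx U]mulmxA UU' mulmx1.
  congr (_ *m U); rewrite -mulmxA mulmx_diag; congr (_ *m diag_mx _).
  by apply/rowP => i; rewrite !mxE exprS rmorphM.
rewrite mxtrace_mulC mulmxA UU' mul1mx mxtrace_diag rmorph_sum.
by apply: eq_bigr => i _; rewrite mxE.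
Qed.

Lemma diag_lambda_max_ge (c : R) : (forall i, 0 <= e i) -> 0 < c ->
  (c <= lambda_max M) <-> (forall k, c ^+ k <= complex.Re (\tr (M ^+ k))).
Proof.
move=> e_ge0 c0; have [i0 -> e_max] := lambda_max_diag; split.
  move=> c_le k; rewrite diag_tr_exp /= (bigD1 i0) //=.
  rewrite -[leLHS]addr0 lerD ?sumr_ge0 //; last by move=> i _; rewrite exprn_ge0.
  by rewrite lerXn2r ?nnegrE // ltW.
move=> H; rewrite leNgt; apply/negP => lt_c.
have r_ge0 : 0 <= e i0 / c by rewrite divr_ge0 // ltW.
have r_lt1 : e i0 / c < 1 by rewrite ltr_pdivrMr // mul1r.
have cvg0 : (fun k => (e i0 / c) ^+ k) @ \oo --> 0.
  by apply: cvg_expr; rewrite ger0_norm.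
(* For k so large that (max e / c)^k < 1/(n+1), the trace is at most (n+1)(max e)^k < c^k, a
   contradiction. *)
have n0 : 0 < (n.+1%:R : R)^-1 by rewrite invr_gt0.
have [k _ /(_ k (leqnn k))] := (@cvgr0_norm_lt _ _ _ _ _ _ cvg0) _ n0.
rewrite /= ger0_norm ?exprn_ge0 // expr_div_n ltr_pdivrMr ?exprn_gt0 // => lt_k.
have := H k; rewrite diag_tr_exp /=; apply/negP; rewrite -ltNge.
apply: (@le_lt_trans _ _ (n.+1%:R * e i0 ^+ k)).
  rewrite -[n.+1 in leRHS]card_ord -sumr_const mulr_suml; apply: ler_sum => i _.
  by rewrite mul1r lerXn2r ?nnegrE.
by rewrite mulrC -ltr_pdivlMr // mulrC.
Qed.
End Spectrum.

Lemma gram_rayleigh (R : realType) n (V : 'M[R[i]]_n.+1) (x : 'cV[R[i]]_n.+1) :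
  (adjmx x *m (adjmx V *m V) *m x) 0 0 <=
    (lambda_max (adjmx V *m V))%:C%C * (adjmx x *m x) 0 0.
Proof.
have [U [e [UU UU' _ ->]]] := gram_spectral _ _ V.
exact: diag_rayleigh.
Qed.

(* With eigenvalues e_i >= 0, tr M^k = sum_i e_i^k dominates (max e)^k and is at
   most n (max e)^k: this expresses the maximal eigenvalue through polynomials in
   the entries, hence gives its measurability. *)
Lemma gram_lambda_max_ge (R : realType) n (V : 'M[R[i]]_n.+1) (c : R) : 0 < c ->
  (c <= lambda_max (adjmx V *m V)) <->
  (forall k, c ^+ k <= complex.Re (\tr ((adjmx V *m V) ^+ k))).
Proof.
move=> c0; have [U [e [UU UU' e_ge0 ->]]] := gram_spectral _ _ V.
exact: diag_lambda_max_ge.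
Qed.

(** * The random Vandermonde matrix *)

(** The k-th term is e^(jk(theta_l - theta_l'))/N. Real and imaginary parts are kept apart, for the
    cosine bound on clusters and for measurability. *)
Lemma vandermonde_gramE (R : realType) N (th : nat -> R) (l l' : 'I_N) :
  (adjmx (vandermonde N th) *m vandermonde N th) l l' =
  \sum_(k < N) (N%:R^-1 * cos (k%:R * (th l - th l')) +i*
                (N%:R^-1 * sin (k%:R * (th l - th l'))))%C.
Proof.
rewrite gram_entry; apply: eq_bigr => k _; rewrite !mxE.
set a := k%:R * th l; set b := k%:R * th l'.
rewrite mulrBr -/a -/b cosB sinB.
rewrite rmorphM fmorphV /= mulrACA -invfM.
have -> : ((Num.sqrt (N%:R : R))%:C%C)^* * (Num.sqrt N%:R)%:C%C = (N%:R : R)%:C%C.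
  by rewrite -[N%:R in RHS]sqr_sqrtr // expr2; apply/eqP;
    rewrite eq_complex /=; apply/andP; split; apply/eqP; ring.
rewrite -fmorphV /=; apply/eqP; rewrite eq_complex /=.
by apply/andP; split; apply/eqP; ring.
Qed.

(** Rayleigh's inequality at the indicator [x] of [S]: the squared norm is #|S|, and the real part
    of the quadratic form is a sum of #|S|^2 averages of cosines, each at least [c]. *)
Lemma lambda_max_cluster (R : realType) n (th : nat -> R) (S : {set 'I_n.+1}) (c : R) :
  S != finset.set0 ->
  (forall l l' (k : 'I_n.+1), l \in S -> l' \in S ->
     c <= cos (k%:R * (th l - th l'))) ->
  c * #|S|%:R <=
  lambda_max (adjmx (vandermonde n.+1 th) *m vandermonde n.+1 th).
Proof.
move=> /set0Pn[l0 l0S] cosS.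
set V := vandermonde _ _; set M := _ *m _.
pose x : 'cV[R[i]]_n.+1 := \col_i (i \in S)%:R.
have := gram_rayleigh _ _ V x; rewrite -/M.
have -> : (adjmx x *m x) 0 0 = (#|S|%:R : R)%:C%C.
  rewrite gram_entry (bigID (mem S)) /= [X in _ + X]big1 ?addr0; last first.
    by move=> i /negbTE iS; rewrite !mxE iS mulr0.
  rewrite (eq_bigr (fun=> 1)); last by move=> i iS; rewrite !mxE iS conjC1 mulr1.
  by rewrite sumr_const rmorph_nat.
have -> : (adjmx x *m M *m x) 0 0 = \sum_(l' in S) \sum_(l in S) M l l'.
  rewrite mxE (bigID (mem S)) /= [X in _ + X]big1 ?addr0; last first.
    by move=> i /negbTE iS; rewrite [x _ _]mxE iS mulr0.
  apply: eq_bigr => l' l'S; rewrite [x _ _]mxE l'S mulr1 mxE.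
  rewrite (bigID (mem S)) /= [X in _ + X]big1 ?addr0; last first.
    by move=> i /negbTE iS; rewrite !mxE iS conjC0 mul0r.
  by apply: eq_bigr => l lS; rewrite !mxE lS conjC1 mul1r.
rewrite lecE => /andP[_]; rewrite /= mulr0 subr0.
rewrite raddf_sum /=.
have S0 : 0 < #|S|%:R :> R by rewrite ltr0n; apply/card_gt0P; exists l0.
move=> H; rewrite -(ler_pM2r S0); apply: le_trans H.
rewrite -mulrA mulrC -mulrA.
have -> : #|S|%:R * (#|S|%:R * c) = \sum_(l' in S) \sum_(l in S) c.
  by rewrite !sumr_const !mulr_natl.
apply: ler_sum => l' l'S; rewrite raddf_sum; apply: ler_sum => l lS.
rewrite /M vandermonde_gramE raddf_sum /= -mulr_sumr.
rewrite mulrC ler_pdivlMr ?ltr0n // -{1}[n.+1]card_ord.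
by rewrite mulr_natr -sumr_const; apply: ler_sum => k _; apply: cosS.
Qed.

(** * Measurability of the event that the largest eigenvalue exceeds a level *)

Section ComplexMeasurability.
Variables (d : measure_display) (T : measurableType d) (R : realType).

Definition complex_measurable (f : T -> R[i]) :=
  measurable_fun setT (fun w => complex.Re (f w)) /\
  measurable_fun setT (fun w => complex.Im (f w)).

Lemma complex_measurable_cst c : complex_measurable (fun=> c).
Proof. by split; exact: measurable_cst. Qed.

Lemma complex_measurableM f g : complex_measurable f -> complex_measurable g ->
  complex_measurable (fun w => f w * g w).
Proof.
move=> [fR fI] [gR gI].
have E w : f w * g w =
    ((complex.Re (f w) * complex.Re (g w) - complex.Im (f w) * complex.Im (g w)) +i*
     (complex.Re (f w) * complex.Im (g w) + complex.Im (f w) * complex.Re (g w)))%C.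
  by case: (f w) (g w) => a b [a' b'].
split; under eq_fun => w do rewrite E /=.
  by apply: measurable_funB; apply: measurable_funM.
by apply: measurable_funD; apply: measurable_funM.
Qed.

Lemma complex_measurable_sum (I : finType) (f : I -> T -> R[i]) :
  (forall i, complex_measurable (f i)) ->
  complex_measurable (fun w => \sum_i f i w).
Proof.
move=> mf; split.
  under eq_fun => w do rewrite raddf_sum.
  by apply: measurable_sum => i; case: (mf i).
under eq_fun => w do rewrite raddf_sum.
by apply: measurable_sum => i; case: (mf i).
Qed.

Lemma complex_measurable_mxexp n (M : T -> 'M[R[i]]_n.+1) k :
  (forall i j, complex_measurable (fun w => M w i j)) ->
  forall i j, complex_measurable (fun w => (M w ^+ k) i j).
Proof.
move=> mM; elim: k => [|k IH] i j.
  by under eq_fun => w do rewrite expr0; exact: complex_measurable_cst.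
under eq_fun => w do rewrite exprS mxE.
by apply: complex_measurable_sum => h; apply: complex_measurableM.
Qed.

(** By the trace criterion the event is a countable intersection of events on traces of powers,
    which are polynomials in Gram entries and so measurable functions of the phases. *)
Lemma measurable_lambda_max_ge n (th : nat -> T -> R) (c : R) :
  (forall l, measurable_fun setT (th l)) -> 0 < c ->
  measurable [set w | c <= lambda_max
    (adjmx (vandermonde n.+1 (th^~ w)) *m vandermonde n.+1 (th^~ w))].
Proof.
move=> mth c0; pose M w := adjmx (vandermonde n.+1 (th^~ w)) *m vandermonde n.+1 (th^~ w).
rewrite -/(M _).
have -> : [set w | c <= lambda_max (M w)] =
    \bigcap_k [set w | c ^+ k <= complex.Re (\tr (M w ^+ k))].
  apply/seteqP; split => w /=.
    by move=> cw k _; have [H _] := gram_lambda_max_ge _ _ (vandermonde n.+1 (th^~ w)) _ c0; exact: H.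
  move=> H; have [_] := gram_lambda_max_ge _ _ (vandermonde n.+1 (th^~ w)) _ c0.
  by apply=> k; exact: H.
apply: bigcap_measurableType => k _.
have [mtr _] : complex_measurable (fun w => \tr (M w ^+ k)).
  apply: complex_measurable_sum => i; apply: complex_measurable_mxexp => {}i j.
  under eq_fun => w do rewrite vandermonde_gramE.
  have marg (h : nat) : measurable_fun setT (fun w => h%:R * (th i w - th j w)).
    by apply: measurable_funM => //; apply: measurable_funB.
  apply: complex_measurable_sum => h; split => /=; apply: measurable_funM => //.
    apply: (measurableT_comp _ (marg h)); apply: continuous_measurable_fun.
    exact: continuous_cos.
  apply: (measurableT_comp _ (marg h)); apply: continuous_measurable_fun.
  exact: continuous_sin.
rewrite -[X in measurable X]setTI.
exact: (measurable_fun_le measurableT).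
Qed.
End ComplexMeasurability.

(** * Second moment method *)

(** Indexing by [option I] adjoins one extra term to a finite sum, as the second moment inequality
    requires on both sides. *)
Lemma sum_option (V : nmodType) (I : finType) (F : option I -> V) :
  \sum_k F k = F None + \sum_i F (Some i).
Proof.
rewrite (bigD1 None) //=; congr (_ + _).
rewrite (reindex_omap Some id) //=; last by case.
by apply: eq_bigl => i; rewrite eqxx.
Qed.

Section SecondMoment.
Variables (d : measure_display) (T : measurableType d) (R : realType).
Variable P : probability T R.

Lemma integral_sum_indic (I : finType) (a : I -> R) (A : I -> set T) :
  (forall i, 0 <= a i) -> (forall i, measurable (A i)) ->
  (\int[P]_w (\sum_i a i * \1_(A i) w)%:E)%E = (\sum_i a i * fine (P (A i)))%:E.
Proof.
move=> a0 mA; under eq_integral => w _ do rewrite -sumEFin.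
rewrite ge0_integral_sum //; last 2 first.
- by move=> i; apply/measurable_EFinP; apply: measurable_funM.
- by move=> i w _; rewrite lee_fin mulr_ge0.
rewrite -sumEFin; apply: eq_bigr => i _.
under eq_integral => w _ do rewrite EFinM.
rewrite ge0_integralZl_EFin //.
- by rewrite integral_indic // setIT EFinM fineK // fin_num_measure.
- by apply/measurable_EFinP; exact: measurable_indic.
Qed.

Lemma ler_sum_indic_probability (I J : finType) (a : I -> R) (b : J -> R)
    (A : I -> set T) (B : J -> set T) :
  (forall i, 0 <= a i) -> (forall i, measurable (A i)) ->
  (forall j, 0 <= b j) -> (forall j, measurable (B j)) ->
  (forall w, \sum_i a i * \1_(A i) w <= \sum_j b j * \1_(B j) w) ->
  \sum_i a i * fine (P (A i)) <= \sum_j b j * fine (P (B j)).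
Proof.
move=> a0 mA b0 mB ab; rewrite -lee_fin -!integral_sum_indic //.
have msum (K : finType) (c : K -> R) (C : K -> set T) : (forall k, measurable (C k)) ->
    measurable_fun setT (fun w => (\sum_k c k * \1_(C k) w)%:E).
  move=> mC; apply/measurable_EFinP; apply: measurable_sum => k.
  exact: measurable_funM.
apply: ge0_le_integral => //.
- by move=> w _; rewrite lee_fin sumr_ge0 // => i _; rewrite mulr_ge0.
- exact: msum.
- exact: msum.
- by move=> w _; rewrite lee_fin.
Qed.

(* Chebyshev's inequality for X = sum_i 1_(A i), in the form obtained by
   integrating 2cX + c^2 1_(X = 0) <= X^2 + c^2 with c = E X. *)
Lemma second_moment_none (I : finType) (A : I -> set T) (c := \sum_i fine (P (A i))) :
  (forall i, measurable (A i)) ->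
  c ^+ 2 * fine (P (\bigcap_i ~` A i)) <=
  \sum_i \sum_j fine (P (A i `&` A j)) - c ^+ 2.
Proof.
move=> mA; have c0 : 0 <= c by rewrite sumr_ge0 // => i _; rewrite fine_ge0.
have mN : measurable (\bigcap_i ~` A i).
  by apply: fin_bigcap_measurable => // i _; exact: measurableC.
(* On the left [None] carries c^2 1_(X = 0) and [Some i] the terms of 2cX; on the right [None]
   carries the constant c^2 and the pairs expand X^2. *)
pose a (k : option I) := if k is Some _ then 2 * c else c ^+ 2.
pose B k := if k is Some i then A i else \bigcap_i ~` A i.
pose b (k : option (I * I)) : R := if k is Some _ then 1 else c ^+ 2.
pose C k := if k is Some (i, j) then A i `&` A j else setT.
have := @ler_sum_indic_probability _ _ a b B C.
rewrite !sum_option /= -mulr_sumr -/c.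
have -> : \sum_i 1 * fine (P (C (Some i))) = \sum_i \sum_j fine (P (A i `&` A j)).
  by rewrite pair_big /=; apply: eq_bigr => -[i j] _; rewrite mul1r.
rewrite probability_setT /= mulr1 => H.
rewrite -subr_ge0; rewrite -subr_ge0 in H.
suff /H : forall w, \sum_i a i * \1_(B i) w <= \sum_j b j * \1_(C j) w.
  set S := \sum_i _; set Z := fine _ => HH.
  have {HH} : 0 <= c ^+ 2 + S - (c ^+ 2 * Z + 2 * c * c).
    apply: HH.
    - by case=> [i|] /=; rewrite ?mulr_ge0 ?exprn_ge0.
    - by case.
    - by case=> [i|] //=; rewrite exprn_ge0.
    - by case=> [[i j]|] //=; exact: measurableI.
  by move=> ?; lra.
move=> w; rewrite !sum_option /= -mulr_sumr indicT mulr1.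
have -> : \sum_i 1 * \1_(C (Some i)) w = (\sum_i \1_(A i) w) ^+ 2 :> R.
  rewrite expr2 mulr_suml; under [RHS]eq_bigr => i _ do rewrite mulr_sumr.
  rewrite pair_big /=; apply: eq_bigr => -[i j] _.
  by rewrite mul1r /= indicI.
(* Where X = 0 both sides equal c^2; elsewhere their difference is (X - c)^2. *)
have [N|N] := boolP (w \in \bigcap_i ~` A i); rewrite indicE ?N ?(negbTE N).
  rewrite big1 ?mulr0 ?addr0 ?mulr1 ?expr0n ?addr0 //.
  move=> i _; have NA : ~ A i w by exact: (set_mem N).
  by rewrite indicE (@memNset _ (A i) w NA).
set X := \sum_i _; have := sqr_ge0 (X - c); rewrite /= mulr0 => ?.
by rewrite -subr_ge0 (_ : _ - _ = (X - c) ^+ 2) //; ring.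
Qed.
End SecondMoment.

(** * Balls in bins *)

Section Blocks.
Variables (d : measure_display) (T : measurableType d) (R : realType).
Variables (P : probability T R) (m n B : nat).
Variables (Y : 'I_m -> 'I_n -> T -> R) (mu : set R -> R) (bin : 'I_B -> set R).
Hypothesis mY : forall i x, measurable_fun setT (Y i x).
Hypothesis indY : forall C : 'I_m -> 'I_n -> set R,
  (forall i x, measurable (C i x)) ->
  fine (P [set w | forall i x, C i x (Y i x w)]) = \prod_i \prod_x mu (C i x).
Hypotheses (mu_ge0 : forall A, 0 <= mu A) (muT : mu setT = 1) (mu0 : mu set0 = 0).
Hypothesis mbin : forall b, measurable (bin b).
Hypothesis bin_disj : forall b b', b != b' -> bin b `&` bin b' = set0.
Hypothesis bin_small : forall b, n%:R * mu (bin b) <= 1.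

Local Notation p b := (mu (bin b)).

(** Selecting one phase per block, rather than any m-subset, makes the chosen phases distinct
    automatically and turns sums over selectors into m-th powers. *)
Definition full_bin (q : 'I_B * {ffun 'I_m -> 'I_n}) : set T :=
  [set w | forall i, bin q.1 (Y i (q.2 i) w)].

Lemma measurable_full_bin q : measurable (full_bin q).
Proof.
rewrite (_ : full_bin q = \bigcap_i (Y i (q.2 i) @^-1` bin q.1)).
  apply: fin_bigcap_measurable => // i _.
  by rewrite -[X in measurable X]setTI; exact: mY.
by apply/seteqP; split => w /= H i; [move=> _; exact: H | exact: (H i I)].
Qed.

(** Contribution of one block to a joint probability: a phase selected twice must lie in both bins,
    while two different phases are independent. *)
Let g b b' (x y : 'I_n) := if x == y then mu (bin b `&` bin b') else p b * p b'.

Lemma probability_full_binI b b' (s s' : {ffun 'I_m -> 'I_n}) :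
  fine (P (full_bin (b, s) `&` full_bin (b', s'))) = \prod_i g b b' (s i) (s' i).
Proof.
(* Only the phases selected by [s] or [s'] are constrained; the others contribute factors [mu setT]
   = 1. *)
pose C i x := (if x == s i then bin b else setT) `&` (if x == s' i then bin b' else setT).
have -> : full_bin (b, s) `&` full_bin (b', s') = [set w | forall i x, C i x (Y i x w)].
  apply/seteqP; split => w /=.
    by move=> [H H'] i x; split; case: eqP => // ->; [exact: H|exact: H'].
  move=> H; split => i.
    by have [+ _] := H i (s i); rewrite eqxx.
  by have [_] := H i (s' i); rewrite eqxx.
rewrite indY; last by move=> i x; apply: measurableI; case: ifP.
apply: eq_bigr => i _; rewrite /g /C; case: eqVneq => [<-|ss'].
  rewrite (bigD1 (s i)) //= eqxx big1 ?mulr1 // => x /negbTE ->.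
  by rewrite setTI.
have s's : (s' i == s i) = false by rewrite eq_sym; apply/negbTE.
rewrite (bigD1 (s i)) //= (bigD1 (s' i)) /=; last by rewrite s's.
rewrite !eqxx (negbTE ss') s's.
rewrite setIT setTI mulrA big1 ?mulr1 // => x /andP[/negbTE -> /negbTE ->].
by rewrite setTI.
Qed.

Lemma probability_full_bin b s : fine (P (full_bin (b, s))) = \prod_(i < m) p b.
Proof.
rewrite -[full_bin _]setIid probability_full_binI; apply: eq_bigr => i _.
by rewrite /g eqxx setIid.
Qed.

(** Expected number of selectors whose phases all fall in bin b: n^m selectors, each with
    probability (p b)^m. *)
Let y b := (n%:R * p b) ^+ m.

Lemma sum_probability_full_bin : \sum_q fine (P (full_bin q)) = \sum_b y b.
Proof.
rewrite -(pair_big xpredT xpredT (fun b s => fine (P (full_bin (b, s))))) /=.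
apply: eq_bigr => b _; under eq_bigr => s _ do rewrite probability_full_bin.
rewrite -(bigA_distr_bigA (fun _ (_ : 'I_n) => p b)) /=.
by rewrite sumr_const prodr_const !card_ord /y mulr_natl.
Qed.

(** The double sum is the m-th power of the sum of [g] over x, z. For equal bins that sum is at most
    np + (np)^2 <= 2np, as np <= 1; for distinct bins the diagonal vanishes by disjointness, leaving
    at most (np)(np'). *)
Lemma sum_probability_full_binI b b' :
  \sum_s \sum_s' fine (P (full_bin (b, s) `&` full_bin (b', s'))) <=
  (if b == b' then 2 ^+ m * y b else 0) + y b * y b'.
Proof.
under eq_bigr => s _ do under eq_bigr => s' _ do rewrite probability_full_binI.
have g_ge0 x z : 0 <= g b b' x z by rewrite /g; case: ifP => // _; rewrite mulr_ge0.
have -> : \sum_(s : {ffun 'I_m -> 'I_n}) \sum_(s' : {ffun 'I_m -> 'I_n})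
    \prod_i g b b' (s i) (s' i) = (\sum_x \sum_z g b b' x z) ^+ m.
  rewrite -[m in RHS]card_ord -prodr_const.
  rewrite (bigA_distr_bigA (fun _ x => \sum_z g b b' x z)).
  by apply: eq_bigr => s _; rewrite (bigA_distr_bigA (fun i z => g b b' (s i) z)).
have sum_ge0 : 0 <= \sum_x \sum_z g b b' x z.
  by apply: sumr_ge0 => x _; apply: sumr_ge0.
have np_ge0 b0 : 0 <= n%:R * p b0 by rewrite mulr_ge0.
have y_ge0 b0 : 0 <= y b0 by rewrite exprn_ge0.
case: eqVneq => [bb'|bb'].
  apply: (@le_trans _ _ (2 ^+ m * y b)); last by rewrite lerDl mulr_ge0.
  rewrite -exprMn lerXn2r ?nnegrE ?mulr_ge0 //.
  apply: (@le_trans _ _ (\sum_(x < n) (p b + n%:R * p b * p b))).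
    apply: ler_sum => x _; rewrite (bigD1 x) //= {1}/g eqxx -bb' setIid lerD2l.
    apply: (@le_trans _ _ (\sum_(z < n) p b * p b)).
      rewrite [leRHS](bigD1 x) //= -[leLHS]add0r lerD ?mulr_ge0 //.
      by apply: ler_sum => z zx; rewrite /g eq_sym (negbTE zx).
    by rewrite sumr_const card_ord -[leLHS]mulr_natl mulrA.
  rewrite sumr_const card_ord.
  have -> : (p b + n%:R * p b * p b) *+ n = n%:R * p b + n%:R * p b * (n%:R * p b).
    by rewrite -[LHS]mulr_natl; ring.
  by rewrite mulrDl mul1r lerD2l ler_piMl.
rewrite add0r /y -exprMn lerXn2r ?nnegrE ?mulr_ge0 //.
apply: (@le_trans _ _ (\sum_(x < n) \sum_(z < n) p b * p b')).
  apply: ler_sum => x _; apply: ler_sum => z _; rewrite /g; case: ifP => // _.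
  by rewrite bin_disj // mu0 mulr_ge0.
by rewrite !sumr_const !card_ord -mulrnA -[leLHS]mulr_natl natrM mulrACA.
Qed.

(** The number of full pairs has mean c and second moment at most 2^m c + c^2, so Chebyshev's
    inequality gives c^2 P(none) <= 2^m c. *)
Lemma probability_no_full_bin : 0 < \sum_b y b ->
  fine (P (\bigcap_q ~` full_bin q)) <= 2 ^+ m / \sum_b y b.
Proof.
set c := \sum_b y b => c0.
have := @second_moment_none _ _ _ P _ full_bin measurable_full_bin.
rewrite sum_probability_full_bin -/c; set S := \sum_i _ => H.
have S_le : S <= 2 ^+ m * c + c ^+ 2.
  rewrite /S -(pair_big xpredT xpredT (fun b s => \sum_j fine (P (full_bin (b, s) `&` full_bin j)))) /=.
  apply: (@le_trans _ _ (\sum_b \sum_b' ((if b == b' then 2 ^+ m * y b else 0) + y b * y b'))).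
    apply: ler_sum => b _.
    under eq_bigr => s _.
      rewrite -(pair_big xpredT xpredT (fun b' s' => fine (P (full_bin (b, s) `&` full_bin (b', s'))))) /=.
      over.
    rewrite exchange_big /=; apply: ler_sum => b' _.
    exact: sum_probability_full_binI.
  have diag b : \sum_b' (if b == b' then 2 ^+ m * y b else 0) = 2 ^+ m * y b.
    rewrite (bigD1 b) //= eqxx big1 ?addr0 // => b'.
    by rewrite eq_sym => /negbTE ->.
  under eq_bigr => b _ do rewrite big_split /= diag -mulr_sumr.
  by rewrite big_split -mulr_sumr -mulr_suml expr2.
rewrite ler_pdivlMr // -(ler_pM2r c0) -mulrA -expr2 mulrC (le_trans H) //.
by rewrite lerBlDr.
Qed.
End Blocks.

(** * Cutting an independent sequence into blocks *)

Lemma big_ord_mul (R : Type) (idx : R) (op : Monoid.law idx) m n (F : nat -> R) :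
  \big[op/idx]_(l < m * n) F l =
  \big[op/idx]_(i < m) \big[op/idx]_(x < n) F (i * n + x)%N.
Proof.
elim: m => [|m IH]; first by rewrite !big_ord0.
by rewrite big_ord_recr mulSnr big_split_ord /= -IH.
Qed.

Lemma block_independence d (T : measurableType d) (R : realType)
    (P : probability T R) (th : nat -> T -> R) m n (C : 'I_m -> 'I_n -> set R) :
  mutually_independent P th -> measurable_fun setT (th 0%N) ->
  (forall l (A : set R), measurable A -> P (th l @^-1` A) = P (th 0%N @^-1` A)) ->
  (forall i x, measurable (C i x)) ->
  fine (P [set w | forall i x, C i x (th (i * n + x)%N w)]) =
  \prod_i \prod_x fine (P (th 0%N @^-1` C i x)).
Proof.
move=> indep mth law mC.
(* An index l = i n + x is decoded by Euclidean division; the default [setT] occurs only for l >= m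
   n, outside the intersection. *)
pose A l := if insub (l %/ n)%N is Some i then
  if insub (l %% n)%N is Some x then C i x else setT else setT.
have AE (i : 'I_m) (x : 'I_n) : A (i * n + x)%N = C i x.
  have n_gt0 : (0 < n)%N by apply: leq_ltn_trans (ltn_ord x).
  rewrite /A divnMDl // divn_small // addn0 valK.
  by rewrite modnMDl modn_small // valK.
have mA l : measurable (A l).
  by rewrite /A; case: insub => // i; case: insub.
have -> : [set w | forall i x, C i x (th (i * n + x)%N w)] =
    \bigcap_(l in `I_(m * n)) (th l @^-1` A l).
  apply/seteqP; split => w /=.
    move=> H l /= lt_l; rewrite /A; case: insubP => // i _ iE.
    case: insubP => //= x _ xE.
    by have := H i x; rewrite iE xE -divn_eq.
  move=> H i x; rewrite -AE; apply: H => /=.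
  apply: (@leq_trans (i.+1 * n)%N); last by rewrite leq_mul2r ltn_ord orbT.
  by rewrite mulSnr ltn_add2l.
rewrite indep // (big_ord_mul _ _ _ _ _ (fun l => P (th l @^-1` A l))).
transitivity (fine (\prod_i \prod_x (fine (P (th 0%N @^-1` C i x)))%:E)%E).
  congr fine; apply: eq_bigr => i _; apply: eq_bigr => x _.
  rewrite (law (i * n + x)%N) // AE fineK // fin_num_measure //.
  by rewrite -[X in measurable X]setTI; exact: mth.
have prodEFin k (F : 'I_k -> R) : (\prod_(j < k) (F j)%:E = (\prod_(j < k) F j)%R%:E)%E.
  by elim/big_rec2: _ => // j x y _ ->; rewrite EFinM.
apply: (@congr1 _ _ fine _ (_%:E)); apply: etrans (prodEFin _ _).
by apply: eq_bigr => i _; exact: prodEFin.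
Qed.

(** * An interval where the density is bounded above and below *)

(** A density of total mass 1 is positive at some x0; by continuity it stays between a and 3a near
    x0, where a = f(x0)/2. *)
Lemma density_comparable (R : realType) (nu : set R -> \bar R) (f : R -> R) :
  has_continuous_density_on_pi nu f -> nu setT = 1%E ->
  exists a u v : R, [/\ 0 < a, u < v & forall x y, u <= x -> x <= y -> y <= v ->
    ((a * (y - x))%:E <= nu `[x, y[%classic <= (3 * a * (y - x))%:E)%E].
Proof.
move=> [f_ge0 [f_cont nuE]] nuT.
set J := `[- pi, (pi : R)]%classic.
have mJ : measurable J by exact: measurable_itv.
have mf : measurable_fun J f by exact: subspace_continuous_measurable_fun.
have [x0 [Jx0 fx0]] : exists x0, J x0 /\ 0 < f x0.
  apply: contrapT => /forallNP H.
  have : nu setT = 0%E.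
    rewrite nuE // setTI integral0_eq // => x Jx.
    have [f0|//] := eqVneq (f x) 0; first by rewrite f0.
    by move=> fn0; case: (H x); split => //; rewrite lt0r fn0 f_ge0.
  by rewrite nuT => /eqP; rewrite onee_eq0.
have [e e0 He] : exists2 e, 0 < e & forall y, J y -> `|y - x0| < e -> `|f y - f x0| < f x0 / 2.
  have := f_cont; rewrite continuous_subspace_in => /(_ x0 (mem_set Jx0)).
  move=> /cvgrPdist_lt /(_ (f x0 / 2)).
  rewrite divr_gt0 // => /(_ isT).
  rewrite /prop_near1 nbhs_simpl /= -/J => H.
  have {H} : within J (nbhs x0) [set y | `|f x0 - f y| < f x0 / 2].
    by rewrite nbhs_subspace_in.
  move=> /nbhs_ballP[e /= e0 He]; exists e => // y Jy ye.
  by rewrite distrC; apply: He => //; rewrite /ball /= distrC.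
have [u [v [uv uvJ uve]]] : exists u v, [/\ u < v, forall y, u <= y -> y <= v -> J y &
    forall y, u <= y -> y <= v -> `|y - x0| < e].
  have pi0 : 0 < (pi : R) by exact: pi_gt0.
  move: Jx0; rewrite /J /= in_itv /= => /andP[x0l x0r].
  (* The interval extends from x0 towards the side of the origin, so a length h <= pi keeps it
     inside [-pi, pi] even when x0 is an endpoint. *)
  pose h := Num.min (e / 2) pi.
  have h0 : 0 < h by rewrite lt_min pi0 divr_gt0.
  have he : h <= e / 2 by rewrite ge_min lexx.
  have hpi : h <= pi by rewrite ge_min lexx orbT.
  have [x0_le|x0_ge] := leP x0 0.
    exists x0, (x0 + h); split; first lra.
    - by move=> y uy yv; rewrite in_itv /=; apply/andP; split; lra.
    - by move=> y uy yv; rewrite ger0_norm; lra.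
  exists (x0 - h), x0; split; first lra.
  - by move=> y uy yv; rewrite in_itv /=; apply/andP; split; lra.
  - by move=> y uy yv; rewrite ler0_norm; lra.
exists (f x0 / 2), u, v; split; [by rewrite divr_gt0|by []|].
move=> x y ux xy yv.
have sub : `[x, y[%classic `<=` J.
  move=> z /=; rewrite in_itv /= => /andP[xz zy]; apply: uvJ; lra.
have fb z : `[x, y[%classic z -> f x0 / 2 <= f z <= 3 * (f x0 / 2).
  rewrite /= in_itv /= => /andP[xz zy].
  have : `|f z - f x0| < f x0 / 2 by apply: He; [apply: uvJ|apply: uve]; lra.
  by rewrite ltr_norml => /andP[? ?]; apply/andP; split; lra.
have mxy : measurable `[x, y[%classic by exact: measurable_itv.
have leb : lebesgue_measure `[x, y[%classic = (y - x)%:E.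
  by rewrite lebesgue_measure_itv /= lte_fin; case: ltP => // yx;
    rewrite (_ : y = x) ?subrr //; apply/eqP; rewrite eq_le yx.
have mfxy : measurable_fun `[x, y[%classic (EFin \o f).
  by apply/measurable_EFinP; apply: measurable_funS mf.
rewrite nuE // (setIidl sub); apply/andP; split.
  rewrite EFinM -leb -integral_cst //; apply: ge0_le_integral => //.
  - by move=> z _; rewrite lee_fin divr_ge0.
  - by move=> z /fb /andP[]; rewrite lee_fin.
rewrite EFinM -leb -integral_cst //; apply: ge0_le_integral => //.
- by move=> z _; rewrite lee_fin.
- by move=> z /fb /andP[]; rewrite lee_fin.
Qed.

(** * Growth of (D m)^m against N *)

(** With L = ln N, l = ln L and q = L/l, the logarithm of (D m)^m is at most (beta q + 1)(C + l) =
    beta L + O(q), and (1 - beta) L absorbs the error because L >= K q. *)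
Lemma balls_in_bins_asymptotics (R : realType) (beta D eta : R) :
  0 < beta < 1 -> 0 < D -> 0 < eta ->
  exists K, forall N : nat, K <= ln (ln (N%:R : R)) ->
    [/\ 0 < ln (N%:R : R), 0 < ln (ln (N%:R : R)) & forall m, (0 < m)%N ->
      m%:R <= beta * (ln N%:R / ln (ln N%:R)) + 1 ->
      (m <= N)%N /\ (D * m%:R) ^+ m <= eta * N%:R].
Proof.
move=> /andP[b0 b1] D0 eta0.
pose C := `|ln D|; have C_ge0 : 0 <= C by exact: normr_ge0.
have b1' : 0 < 1 - beta by lra.
(* The 2 yields m <= 2q <= L <= N; the fraction makes (1 - beta) L dominate the remaining terms in
   C, l and ln eta. *)
pose K := 2 + (4 * C + 4 + 2 * `|ln eta|) / (1 - beta).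
have K2 : 2 <= K.
  by rewrite lerDl divr_ge0 // ?(ltW b1') //; have := normr_ge0 (ln eta); lra.
exists K => N; set L := ln N%:R; set l := ln L => Kl.
have l0 : 0 < l by lra.
have L0 : 0 < L by rewrite ltNge; apply/negP => /ln0; rewrite -/l; lra.
have N0 : 0 < (N%:R : R) by rewrite ltNge; apply/negP => /ln0; rewrite -/L; lra.
split=> // m m0 m_le.
have lE : expR l = L by rewrite lnK ?posrE.
have LE : expR L = N%:R by rewrite lnK ?posrE.
have L_ge : 1 + l <= L by rewrite -lE expR_ge1Dx.
(* The quadratic term of the exponential series; it gives l <= 2q. *)
have L_ge2 : l ^+ 2 <= 2 * L.
  have := @expR_ge1Dxn R l 1 (ltW l0); rewrite lE (_ : 2`!%:R = 2) //.
  by move=> ?; lra.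
pose q := L / l.
have q0 : 0 < q by rewrite divr_gt0.
have ql : q * l = L by rewrite /q divfK // gt_eqF.
have l_le : l <= 2 * q by rewrite -(ler_pM2r l0) -mulrA ql -expr2.
have q1 : 1 <= q by rewrite -(ler_pM2r l0) ql; lra.
have qK : q * K <= L by rewrite -ql ler_pM2l.
have m_leL : m%:R <= L.
  apply: le_trans m_le _; have : beta * q <= q by rewrite ger_pMl //; lra.
  have : q * 2 <= q * K by rewrite ler_pM2l.
  by rewrite -/q; lra.
have m0' : 0 < (m%:R : R) by rewrite ltr0n.
split.
  by rewrite -(ler_nat R) (le_trans m_leL) // ltW // ln_sublinear.
have Dm0 : 0 < D * m%:R by rewrite mulr_gt0.
rewrite -[D * _]lnK ?posrE // -expRM_natl -LE -[eta]lnK ?posrE // -expRD ler_expR.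
rewrite lnM ?posrE //.
have lnm : ln m%:R <= l by rewrite ler_ln ?posrE.
have lnD : ln D <= C by exact: ler_norm.
have lneta : - `|ln eta| <= ln eta by have := ler_norm (- ln eta); rewrite normrN; lra.
apply: (@le_trans _ _ (m%:R * (C + l))); first by rewrite ler_pM2l // lerD.
apply: (@le_trans _ _ ((beta * q + 1) * (C + l))).
  by rewrite ler_pM2r //; lra.
have -> : (beta * q + 1) * (C + l) = beta * L + beta * (q * C) + C + l.
  by rewrite -ql; ring.
have qC : 0 <= q * C by rewrite mulr_ge0 // ltW.
have h1 : beta * (q * C) <= q * C by rewrite ler_piMl // ltW.
have h2 : C <= q * C by rewrite ler_peMl.
have Kb : (1 - beta) * (K - 2) = 4 * C + 4 + 2 * `|ln eta|.
  by rewrite /K addrAC subrr add0r mulrC divfK // gt_eqF.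
have h3 : (1 - beta) * (q * K) <= (1 - beta) * L by rewrite ler_pM2l.
have h4 : q * (4 * C + 4 + 2 * `|ln eta|) <= (1 - beta) * (q * K).
  rewrite -Kb; have : 0 <= (1 - beta) * q by rewrite mulr_ge0 // ltW.
  by move=> ?; lra.
have h5 : `|ln eta| <= q * `|ln eta| by rewrite ler_peMl.
have h6 : 0 <= `|ln eta| by exact: normr_ge0.
lra.
Qed.

(** * Clusters of phases *)

(** Phases taken from different blocks have distinct indices, and multiplying a gap of at most
    delta/N by k < N leaves it at most delta. *)
Lemma lambda_max_full_bin (R : realType) (N' m n : nat) (th : nat -> R)
    (s : 'I_m -> 'I_n) (delta c : R) :
  (0 < m)%N -> (m * n <= N'.+1)%N ->
  (forall t : R, `|t| <= delta -> c <= cos t) ->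
  (forall i j : 'I_m, `|th (i * n + s i)%N - th (j * n + s j)%N| <= delta / N'.+1%:R) ->
  c * m%:R <= lambda_max (adjmx (vandermonde N'.+1 th) *m vandermonde N'.+1 th).
Proof.
move=> m0 mn cos_ge close.
have idx (i : 'I_m) : (i * n + s i < N'.+1)%N.
  apply: leq_trans mn; apply: (@leq_trans (i.+1 * n)%N).
    by rewrite mulSnr ltn_add2l.
  by rewrite leq_mul2r ltn_ord orbT.
pose h (i : 'I_m) : 'I_N'.+1 := Ordinal (idx i).
have h_inj : injective h.
  move=> i j /(congr1 val) /= /(congr1 (divn^~ n)).
  have n0 : (0 < n)%N by apply: leq_ltn_trans (ltn_ord (s i)).
  by rewrite !divnMDl // !divn_small // !addn0 => /val_inj.
rewrite -[m]card_ord -cardsT -(card_imset _ h_inj).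
apply: lambda_max_cluster.
  by apply/set0Pn; exists (h (Ordinal m0)); rewrite imset_f.
move=> _ _ k /imsetP[i _ ->] /imsetP[j _ ->]; apply: cos_ge.
rewrite normrM ger0_norm ?ler0n //.
apply: (@le_trans _ _ (N'.+1%:R * (delta / N'.+1%:R))).
  by apply: ler_pM => //; [rewrite ler_nat ltnW | exact: close].
by rewrite mulrC divfK // pnatr_eq0.
Qed.

Section Cluster.
Variables (R : realType) (d : measure_display) (T : measurableType d).
Variables (P : probability T R) (nu : set R -> \bar R) (th : nat -> T -> R).
Hypothesis mth : forall l, measurable_fun setT (th l).
Hypothesis th_law : forall l (A : set R), measurable A -> P (th l @^-1` A) = nu A.
Hypothesis th_indep : mutually_independent P th.
Variables (a u v delta c : R).
Hypotheses (a0 : 0 < a) (delta0 : 0 < delta) (delta_uv : delta <= v - u).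
Hypothesis delta_a : 3 * a * delta <= 1.
Hypothesis nu_cmp : forall x y, u <= x -> x <= y -> y <= v ->
  ((a * (y - x))%:E <= nu `[x, y[%classic <= (3 * a * (y - x))%:E)%E.
Hypothesis cos_ge : forall t : R, `|t| <= delta -> c <= cos t.
Hypothesis c0 : 0 < c.

(** The N bins of width delta/N starting at u fit in [u, v]. With n = floor(N/m), each has n p_b >=
    a delta/(2m), which bounds the mean number of full pairs from below. *)
Lemma probability_lambda_max_lt N' m : (0 < m <= N'.+1)%N ->
  fine (P (~` [set w | c * m%:R <= lambda_max
    (adjmx (vandermonde N'.+1 (th^~ w)) *m vandermonde N'.+1 (th^~ w))])) <=
  2 ^+ m / (N'.+1%:R * (a * delta / (2 * m%:R)) ^+ m).
Proof.
move=> /andP[m0 mN]; set N := N'.+1.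
pose n := (N %/ m)%N.
have mn : (m * n <= N)%N by rewrite mulnC leq_trunc_div.
have n0 : (0 < n)%N by rewrite divn_gt0.
(* Rounding N/m down loses at most a factor 2, since m <= N. *)
have N_le : (N <= 2 * m * n)%N.
  rewrite {1}(divn_eq N m) -/n; have := ltn_pmod N m0 => H.
  by rewrite -mulnA mul2n -addnn mulnC leq_add2l (leq_trans (ltnW H)) // leq_pmulr.
have N0 : 0 < (N%:R : R) by rewrite ltr0n.
have m0' : 0 < (m%:R : R) by rewrite ltr0n.
have n0' : 0 < (n%:R : R) by rewrite ltr0n.
pose left (b : nat) : R := u + b%:R * (delta / N%:R).
have wid0 : 0 < delta / N%:R by rewrite divr_gt0.
have leftS b : left b.+1 = left b + delta / N%:R by rewrite /left -natr1; ring.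
have left_ge b : u <= left b by rewrite lerDl mulr_ge0 // ltW.
have left_le b : (b <= N)%N -> left b <= v.
  move=> bN; apply: (@le_trans _ _ (u + delta)); last by rewrite -lerBrDl.
  rewrite lerD2l mulrC -mulrA ger_pMr // mulrC ler_pdivrMr // mul1r ler_nat //.
have left_mono b b' : (b <= b')%N -> left b <= left b'.
  by move=> bb; rewrite lerD2l ler_pM2r // ler_nat.
pose bin (b : 'I_N) : set R := `[left b, left b.+1[%classic.
have mbin b : measurable (bin b) by exact: measurable_itv.
pose mu (A : set R) := fine (P (th 0%N @^-1` A)).
have muE A : measurable A -> mu A = fine (nu A) by move=> mA; rewrite /mu th_law.
have p_cmp b : a * (delta / N%:R) <= mu (bin b) <= 3 * a * (delta / N%:R).
  have := nu_cmp _ _ (left_ge b) (left_mono _ _ (leqnSn b)) (left_le _ (ltn_ord b)).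
  rewrite leftS addrAC subrr add0r -leftS -/(bin b) muE //.
  rewrite -[nu _]fineK ?lee_fin //.
  rewrite -(th_law 0%N) // fin_num_measure // -[X in measurable X]setTI.
  exact: mth.
have := @probability_no_full_bin _ _ _ P m n N (fun i x => th (i * n + x)%N) mu bin.
set full := full_bin _ _ _ _ _ _ _ _ => H.
have sum_ge : N%:R * (a * delta / (2 * m%:R)) ^+ m <= \sum_b (n%:R * mu (bin b)) ^+ m.
  rewrite mulr_natl -[N in _ *+ N]card_ord -sumr_const; apply: ler_sum => b _.
  have ad0 : 0 <= a * delta by rewrite mulr_ge0 // ltW.
  have mu_ge0 : 0 <= mu (bin b) by rewrite fine_ge0.
  apply: lerXn2r; rewrite ?nnegrE.
  - by rewrite divr_ge0 // mulr_ge0 // ltW.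
  - by rewrite mulr_ge0.
  have /andP[pl _] := p_cmp b.
  apply: (@le_trans _ _ (n%:R * (a * (delta / N%:R)))); last by rewrite ler_pM2l.
  rewrite ler_pdivrMr ?mulr_gt0 //.
  have -> : n%:R * (a * (delta / N%:R)) * (2 * m%:R) = a * delta * ((2 * m * n)%:R / N%:R).
    by rewrite !natrM; ring.
  by rewrite ler_peMr // ler_pdivlMr // mul1r ler_nat.
have low0 : 0 < N%:R * (a * delta / (2 * m%:R)) ^+ m.
  by rewrite mulr_gt0 // exprn_gt0 // divr_gt0 ?mulr_gt0.
have mfull q : measurable (full q).
  by apply: measurable_full_bin => // i x; exact: mth.
(* A full bin would force the eigenvalue up to c m, so a small eigenvalue excludes every full
   bin. *)
apply: (@le_trans _ _ (fine (P (\bigcap_q ~` full q)))).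
  have mlam := @measurable_lambda_max_ge _ _ _ N' th _ mth (mulr_gt0 c0 m0').
  have mcap : measurable (\bigcap_q ~` full q).
    by apply: fin_bigcap_measurable => // q _; exact: measurableC.
  have mlamC := measurableC mlam.
  apply: fine_le; [exact: fin_num_measure | exact: fin_num_measure |].
  apply: le_measure; rewrite ?inE //.
  move=> w /= lam [b s] _ full_w; apply: lam.
  apply: (lambda_max_full_bin _ _ _ n _ s delta) => // i j.
  have /= := full_w i; have /= := full_w j; rewrite /bin /= !in_itv /= leftS.
  move=> /andP[? ?] /andP[? ?]; rewrite ler_norml -/N; apply/andP; split; lra.
have sum0 := lt_le_trans low0 sum_ge.
apply: (@le_trans _ _ (2 ^+ m / \sum_b (n%:R * mu (bin b)) ^+ m)); last first.
  by rewrite ler_pM2l ?exprn_gt0 // lef_pV2 ?posrE.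
apply: H sum0 => //.
- move=> C mC; apply: block_independence => // l A mA.
  by rewrite !th_law.
- by move=> A; rewrite fine_ge0.
- by rewrite /mu preimage_setT probability_setT.
- by rewrite /mu preimage_set0 measure0.
- move=> b b' bb'; apply/seteqP; split => // x; rewrite /bin /= !in_itv /=.
  move=> [/andP[? ?] /andP[? ?]].
  move: bb'; rewrite neq_ltn => /orP[] lt_b.
  + by have := left_mono _ _ lt_b; lra.
  + by have := left_mono _ _ lt_b; lra.
- move=> b; have /andP[_ pu] := p_cmp b.
  apply: (@le_trans _ _ (N%:R * (3 * a * (delta / N%:R)))).
    by apply: ler_pM => //; [exact: fine_ge0 | rewrite ler_nat leq_div].
  by rewrite mulrCA (mulrC N%:R) divfK ?gt_eqF.
Qed.
End Cluster.

(** * Choice of parameters and passage to the limit *)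

Theorem theorem6 (R : realType) (d : measure_display) (T : measurableType d)
  (P : probability T R) (nu : set R -> \bar R) (f : R -> R)
  (th : nat -> T -> R) (alpha : R) :
  has_continuous_density_on_pi nu f ->
  (forall l, measurable_fun setT (th l)) ->
  (forall l (A : set R), measurable A -> P (th l @^-1` A) = nu A) ->
  mutually_independent P th ->
  0 < alpha < 1 ->
  (fun N : nat =>
     P [set w | alpha * ln (N%:R : R) / ln (ln (N%:R : R))
                <= lambda_max (adjmx (vandermonde N (fun l => th l w))
                               *m vandermonde N (fun l => th l w))])
    @ \oo --> 1%E.
Proof.
move=> nu_f mth th_law th_indep /andP[alpha0 alpha1].
have nuT : nu setT = 1%E by rewrite -(th_law 0%N) // preimage_setT probability_setT.
have [a [u [v [a0 uv nu_cmp]]]] := density_comparable _ _ _ nu_f nuT.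
(* [beta] lies strictly between alpha and 1; the slack c = alpha/beta < 1 pays for replacing cos by
   its lower bound on the cluster. *)
pose beta := (1 + alpha) / 2; pose c := alpha / beta.
have beta01 : 0 < beta < 1 by apply/andP; split; rewrite /beta; lra.
have /andP[beta0 beta1] := beta01.
have c0 : 0 < c by rewrite divr_gt0.
have c1 : c < 1 by rewrite ltr_pdivrMr // mul1r /beta; lra.
have cb : c * beta = alpha by rewrite /c divfK // gt_eqF.
have [e e0 cos_e] : exists2 e, 0 < e & forall t : R, `|t| < e -> c <= cos t.
  have := @continuous_cos R 0 => /cvgrPdist_le /(_ (1 - c)).
  rewrite subr_gt0 => /(_ c1); rewrite cos0 => /nbhs_ballP[e /= e0 He].
  exists e => // t te; have := He t; rewrite /ball /= sub0r normrN => /(_ te).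
  by rewrite ler_distlC => /andP[? _]; lra.
have a3 : 0 < 3 * a by rewrite mulr_gt0.
(* The three bounds ensure respectively cos >= c on [-delta, delta], room for the bins in [u, v],
   and n p_b <= 1. *)
pose delta := Num.min (Num.min (e / 2) (v - u)) (3 * a)^-1.
have delta0 : 0 < delta by rewrite !lt_min divr_gt0 // subr_gt0 uv invr_gt0.
have delta_e : delta < e.
  by apply: (@le_lt_trans _ _ (e / 2)); [rewrite !ge_min lexx | lra].
have delta_uv : delta <= v - u by rewrite !ge_min lexx !orbT.
have delta_a : 3 * a * delta <= 1.
  by rewrite mulrC -ler_pdivlMr // mul1r !ge_min lexx !orbT.
have cos_ge (t : R) : `|t| <= delta -> c <= cos t.
  by move=> td; apply: cos_e; exact: le_lt_trans delta_e.
pose E N (x : R) := [set w | x <= lambda_max (adjmx (vandermonde N (th^~ w))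
  *m vandermonde N (th^~ w))].
pose tau (N : nat) : R := alpha * ln N%:R / ln (ln N%:R).
have ad0 : 0 < a * delta by rewrite mulr_gt0.
pose D := 4 / (a * delta).
have D0 : 0 < D by rewrite divr_gt0.
have key (eta : R) : 0 < eta -> \forall N \near \oo,
    measurable (E N (tau N)) /\ fine (P (~` E N (tau N))) <= eta.
  move=> eta0; have [K HK] := balls_in_bins_asymptotics _ _ _ _ beta01 D0 eta0.
  have large N : K <= ln (ln (N%:R : R)) ->
      measurable (E N (tau N)) /\ fine (P (~` E N (tau N))) <= eta.
    (* N = 0 is impossible here: ln 0 is 0 by convention, against ln N > 0. *)
    case: N => [|N'] NK; have [L0 l0 HN] := HK _ NK; first by move: L0; rewrite ln0 // ltxx.
    set N := N'.+1.
    pose q := ln (N%:R : R) / ln (ln N%:R).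
    have q0 : 0 < beta * q by rewrite mulr_gt0 // divr_gt0.
    (* Thus beta q < m <= beta q + 1: the left inequality gives c m >= tau N, the right one the
       growth bound. *)
    pose m := (Num.truncn (beta * q)).+1.
    have [|mN Dm] := HN m isT; first by rewrite /m -[leLHS]natr1 lerD2r truncn_le ltW.
    have m0 : 0 < (m%:R : R) by rewrite ltr0n.
    have tau_cm : tau N <= c * m%:R.
      rewrite /tau -mulrA -/q -cb -mulrA ler_pM2l //.
      by rewrite ltW // truncnS_gt.
    have tau0 : 0 < tau N by rewrite /tau -mulrA mulr_gt0 // divr_gt0.
    have ltP := probability_lambda_max_lt _ _ _ _ _ _ mth th_law th_indep _ _ _ _ _
      a0 delta0 delta_uv delta_a nu_cmp cos_ge c0.
    have N0 : 0 < (N%:R : R) by rewrite ltr0n.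
    have mE x : 0 < x -> measurable (E N x) by exact: measurable_lambda_max_ge.
    split; first exact: mE.
    have cm0 : 0 < c * m%:R by rewrite mulr_gt0.
    apply: (@le_trans _ _ (fine (P (~` E N (c * m%:R))))).
      have mC x : 0 < x -> measurable (~` E N x) by move=> /mE; exact: measurableC.
      apply: fine_le; [exact/fin_num_measure/mC | exact/fin_num_measure/mC |].
      apply: le_measure; rewrite ?inE; [exact: mC | exact: mC |].
      by move=> w /= lt_tau le_cm; apply: lt_tau; exact: le_trans le_cm.
    apply: le_trans (ltP N' m _) _; first by rewrite mN.
    (* The factors 2 and 2m/(a delta) combine into D m, with D = 4/(a delta). *)
    have -> : 2 ^+ m / (N'.+1%:R * (a * delta / (2 * m%:R)) ^+ m) = (D * m%:R) ^+ m / N%:R.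
      rewrite invfM mulrCA -exprVn -exprMn mulrC; congr (_ ^+ _ / _).
      by rewrite /D; field; rewrite !gt_eqF.
    by rewrite ler_pdivrMr.
  near=> N; apply: large.
  have NeK : expR (expR K) <= N%:R by near: N; exact: nbhs_infty_ger.
  have N0 : 0 < (N%:R : R) by apply: lt_le_trans NeK; exact: expR_gt0.
  have LeK : expR K <= ln N%:R by rewrite -[leLHS]expRK ler_ln ?posrE ?expR_gt0.
  rewrite -[leLHS]expRK ler_ln ?posrE ?expR_gt0 //.
  exact: lt_le_trans (expR_gt0 K) LeK.
apply/fine_cvgP; split.
  by apply: filterS (key 1 ltr01) => N [mE _]; exact: fin_num_measure.
apply/cvgrPdist_le => eta eta0; apply: filterS (key eta eta0) => N [mE].
rewrite probability_setC // fineB ?fin_num_measure // => PE.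
rewrite ger0_norm //= subr_ge0 -lee_fin fineK ?fin_num_measure //.
exact: probability_le1.
Unshelve. all: by end_near.
Qed.
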